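(* Let $\mathcal H$ be a real Hilbert space, let $\Phi:\mathcal H\to\mathbb{R}\cup\{+\infty\}$ be a convex lower semicontinuous proper function, let $B:\mathcal H\to\mathcal H$ be $\beta$-cocoercive for some $\beta>0$, and let $\lambda>0$. Suppose that $S=\{z\in\mathcal H:\ \partial\Phi(z)+Bz\ni0\}$ is nonempty and that $\Phi$ is boundedly inf-compact, i.e. the intersections of the sublevel sets of $\Phi$ with closed balls of $\mathcal H$ are relatively compact sets. Then for any strong global solution $(x(\cdot),v(\cdot))$ of $$v(t)\in\partial\Phi(x(t)),\qquad \lambda\dot x(t)+\dot v(t)+v(t)+B(x(t))=0 ,$$ $x(t)$ converges strongly as $t\to+\infty$, and its limit belongs to $S$.
   Context: $\partial\Phi$ denotes the convex subdifferential. $B:\mathcal H\to\mathcal H$ is $\beta$-cocoercive if $\langle Bx-By,x-y\rangle\ge\beta\|Bx-By\|^2$ for all $x,y\in\mathcal H$. A strong global solution of the system is a pair $(x(\cdot),v(\cdot)):[0,+\infty[\,\to\mathcal H\times\mathcal H$ such that: $x$ and $v$ are absolutely continuous on each interval $[0,b]$, $0<b<+\infty$; $v(t)\in\partial\Phi(x(t))$ for all $t\ge 0$; $\lambda\dot x(t)+\dot v(t)+v(t)+B(x(t))=0$ for almost all $t\ge0$. *)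

(* Defs.v *)
From HB Require Import structures.
From mathcomp Require Import all_boot all_order all_algebra.
From mathcomp Require Import all_classical all_reals all_analysis.

Set Implicit Arguments.
Unset Strict Implicit.
Unset Printing Implicit Defensive.

Import Order.TTheory GRing.Theory Num.Theory.
Import numFieldNormedType.Exports.

Local Open Scope classical_set_scope.
Local Open Scope ring_scope.

(* A real Hilbert space is a complete normed module [H] over a [realType],
   together with a real inner product [dot : {dot H for idfun}] (bilinear,
   symmetric, positive definite) which induces the norm of [H]. *)
Definition induces_norm (R : realType) (H : completeNormedModType R)
    (dot : {dot H for idfun}) : Prop :=
  forall u : H, `|u| = Num.sqrt (dot u u).

Section ExtendedRealFunctions.
Context (R : realType) (H : completeNormedModType R).
Implicit Type Phi : H -> \bar R.

Definition proper_fun Phi : Prop :=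
  (forall x, Phi x != -oo%E) /\ (exists x, Phi x != +oo%E).

(* To be used for functions which do not take the value [-oo], so that no
   indeterminate sum [+oo - oo] occurs on the right-hand side. *)
Definition convex_efun Phi : Prop :=
  forall (x y : H) (t : R), 0 < t < 1 ->
    (Phi (t *: x + (1 - t) *: y)%R
       <= t%:E * Phi x + (1 - t)%R%:E * Phi y)%E.

Definition boundedly_inf_compact Phi : Prop :=
  forall (a : R) (c : H) (r : R), 0 < r ->
    precompact ([set x | (Phi x <= a%:E)%E] `&` closed_ball c r).

End ExtendedRealFunctions.

Section InnerProduct.
Context (R : realType) (H : completeNormedModType R).
Variable dot : {dot H for idfun}.
Implicit Types (Phi : H -> \bar R) (B : H -> H).

(* If [Phi] is proper, then [subdifferential Phi x] is empty as soon as
   [Phi x = +oo]. *)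
Definition subdifferential Phi (x : H) : set H :=
  [set p | forall y, (Phi x + (dot p (y - x)%R)%:E <= Phi y)%E].

Definition cocoercive (beta : R) B : Prop :=
  forall x y : H, beta * `|B x - B y| ^+ 2 <= dot (B x - B y) (x - y).

Definition solution_set Phi B : set H :=
  [set z | exists2 p, subdifferential Phi z p & p + B z = 0].

End InnerProduct.

(* The classical epsilon-delta definition, for finite families of pairwise
   disjoint open subintervals of [a, b]. *)
Definition absolutely_continuous_on (R : realType) (V : normedModType R)
    (a b : R) (f : R -> V) : Prop :=
  forall eps : R, 0 < eps -> exists2 delta : R, 0 < delta &
    forall (n : nat) (s e : 'I_n -> R),
      (forall i, a <= s i /\ s i <= e i /\ e i <= b) ->
      trivIset [set: 'I_n] (fun i => `]s i, e i[%classic) ->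
      \sum_(i < n) (e i - s i) <= delta ->
      \sum_(i < n) `|f (e i) - f (s i)| <= eps.

(* Functions on [0, +oo[ are represented by functions on [R]; their values at
   negative times are irrelevant (the derivatives at [t = 0] do depend on them,
   but [0] is negligible).  Since [derive1 x t] has an arbitrary value where [x] is
   not derivable, the existence of the derivatives is part of the equation. *)
Definition strong_global_solution (R : realType) (H : completeNormedModType R)
    (dot : {dot H for idfun}) (Phi : H -> \bar R) (B : H -> H) (lambda : R)
    (x v : R -> H) : Prop :=
  [/\ forall b : R, 0 < b ->
        absolutely_continuous_on 0 b x /\ absolutely_continuous_on 0 b v,
      forall t : R, 0 <= t -> subdifferential dot Phi (x t) (v t) &
      {ae @lebesgue_measure R, forall t : R, 0 <= t ->
        [/\ derivable x t 1, derivable v t 1 &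
            lambda *: derive1 x t + derive1 v t + v t + B (x t) = 0]}].

(* Main.v *)
Require Import Defs.
From mathcomp Require Import all_boot all_order all_algebra.
From mathcomp Require Import all_classical all_reals all_analysis.
From mathcomp Require Import ring lra.

Set Implicit Arguments.
Unset Strict Implicit.
Unset Printing Implicit Defensive.

Import Order.TTheory GRing.Theory Num.Theory.
Import numFieldNormedType.Exports.

Local Open Scope classical_set_scope.
Local Open Scope ring_scope.

(* Write q = v + B x, so that lambda x' + v' = - q almost everywhere, and let
   z be a solution, with p = - B z. The function
     E_z = lambda / 2 |x - z|^2 + (Phi z - Phi x - <v, z - x>)
   is nonnegative and, since (Phi o x)' = <v, x'>, its derivative
   - <q, x - z> is at most - beta |B x - B z|^2. Hence the derivative of
     E_z / (2 beta) + lambda (Phi x + <B z, x>) + |v - p|^2 / 2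
   is at most - |q|^2 / 2. As this second function is bounded below, q becomes
   arbitrarily small at arbitrarily large times, while x and Phi x stay bounded;
   by inf-compactness there are times s_n -> +oo with x (s_n) -> xoo and
   q (s_n) -> 0. Closedness of the graph of the subdifferential puts xoo in the
   solution set, and E_xoo (s_n) -> 0 by lower semicontinuity. Since E_xoo is
   nonincreasing, it tends to 0, and x converges to xoo. *)

(** * Absolutely continuous functions *)

(** Let [c] be the supremum of the [t] with [P a t]. A small interval that starts close below [c]
    extends [P a] beyond [c] unless it can already end at [b]. This stands in for the compactness of
    [[a, b]]. *)
Lemma cousin_ind (R : realType) (P : R -> R -> Prop) (a b : R) : a <= b ->
    (forall u v w, P u v -> P v w -> P u w) ->
    (forall t, a <= t <= b -> exists2 d, 0 < d & forall u w,
       a <= u <= t -> t <= w <= b -> t - d < u -> w < t + d -> P u w) ->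
  P a b.
Proof.
move=> ab Ptrans Ploc.
pose A := [set t | a <= t <= b /\ P a t].
have Aa : A a.
  split; first by rewrite lexx.
  have [|d d0 Pd] := Ploc a; first by rewrite lexx.
  by apply: Pd; rewrite ?lexx ?ab//; lra.
have supA : has_sup A.
  by split; [exists a | exists b => t [/andP[]]].
pose c := sup A.
have ac : a <= c by exact: (sup_upper_bound supA).
have cb : c <= b by apply: ge_sup; [exists a | move=> t [/andP[]]].
have [|d d0 Pd] := Ploc c; first by rewrite ac.
have [u [/andP[au ub] Pau] cdu] := sup_adherent d0 supA.
have uc : u <= c by apply: (sup_upper_bound supA); rewrite /A/= au.
have [cdb|bcd] := ltP b (c + d).
  by apply: Ptrans Pau _; apply: Pd; rewrite ?au ?cb ?lexx.
suff : c + d / 2 <= c by lra.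
apply: (sup_upper_bound supA).
split; first by lra.
by apply: Ptrans Pau _; apply: Pd => //; rewrite ?au ?uc /=; lra.
Qed.

Section absolute_continuity.
Context (R : realType).
Implicit Types (a b : R).

(** The closure properties below all reduce to this one: increments dominated by those of two
    absolutely continuous functions have small sums too. *)
Lemma absolutely_continuous_on_lipschitz (U V W : normedModType R) a b (C : R)
    (g : R -> U) (h : R -> V) (f : R -> W) : 0 <= C ->
    (forall s t, a <= s -> s <= t -> t <= b ->
      `|f t - f s| <= C * (`|g t - g s| + `|h t - h s|)) ->
    absolutely_continuous_on a b g -> absolutely_continuous_on a b h ->
  absolutely_continuous_on a b f.
Proof.
move=> C0 fC acg ach eps eps0.
(* The factor 2 shares [eps] between [g] and [h]; [C + 1] keeps the divisor positive when
   [C = 0]. *)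
pose eta := eps / (2 * (C + 1)).
have eta0 : 0 < eta by rewrite divr_gt0//; lra.
have [dg dg0 Hg] := acg _ eta0; have [dh dh0 Hh] := ach _ eta0.
exists (Num.min dg dh); first by rewrite lt_min dg0.
move=> n s e se trse; rewrite le_min => /andP[sedg sedh].
apply: (@le_trans _ _
    (\sum_(i < n) C * (`|g (e i) - g (s i)| + `|h (e i) - h (s i)|))).
  by apply: ler_sum => i _; have [? [? ?]] := se i; exact: fC.
rewrite -mulr_sumr big_split/=.
have := Hg _ _ _ se trse sedg; have := Hh _ _ _ se trse sedh.
set X := \sum_i _; set Y := \sum_i _ => Xe Ye.
apply: (@le_trans _ _ ((C + 1) * (eta + eta))); last first.
  suff -> : (C + 1) * (eta + eta) = eps by [].
  by rewrite /eta; field; lra.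
apply: ler_pM => //; [|lra|lra].
by rewrite addr_ge0// /X /Y sumr_ge0.
Qed.

Lemma absolutely_continuous_on_modulus (V : normedModType R) a b (f : R -> V) :
  absolutely_continuous_on a b f -> forall eps, 0 < eps ->
  exists2 d, 0 < d & forall s t, a <= s -> s <= t -> t <= b -> t - s <= d ->
    `|f t - f s| <= eps.
Proof.
move=> acf eps eps0; have [d d0 Hd] := acf _ eps0; exists d.
  by [].
move=> s t as_ st tb std.
have := Hd 1%N (fun=> s) (fun=> t); rewrite !big_ord1; apply => //.
by move=> i j _ _ _; rewrite !ord1.
Qed.

(** Bounds on two adjacent intervals give one on their union, and within the modulus [d] of a point
    [f] varies by at most 1, so [cousin_ind] applies. *)
Lemma absolutely_continuous_on_bounded (V : normedModType R) a b (f : R -> V) :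
  a <= b -> absolutely_continuous_on a b f ->
  exists2 M, 0 < M & forall t, a <= t <= b -> `|f t| <= M.
Proof.
move=> ab acf; have [d d0 fd] := absolutely_continuous_on_modulus acf ltr01.
apply: (@cousin_ind _ (fun u w =>
    exists2 M, 0 < M & forall t, u <= t <= w -> `|f t| <= M)) => //.
  move=> u v w [M M0 HM] [N N0 HN]; exists (Num.max M N).
    by rewrite lt_max M0.
  move=> t /andP[ut tw]; rewrite le_max; have [tv|vt] := leP t v.
    by rewrite HM ?ut.
  by rewrite HN ?orbT// (ltW vt).
move=> t /andP[at_ tb]; exists d => // u w /andP[au ut] /andP[tw wb] du dw.
exists (`|f t| + 1); first by rewrite ltr_wpDl.
move=> s /andP[us sw]; rewrite -lerBlDl; apply: le_trans (lerB_dist _ _) _.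
by have [st|ts] := leP s t; [rewrite distrC|]; apply: fd; lra.
Qed.

End absolute_continuity.

Lemma absolutely_continuous_onS (R : realType) (V : normedModType R)
    (a b c d : R) (f : R -> V) : a <= c -> d <= b ->
  absolutely_continuous_on a b f -> absolutely_continuous_on c d f.
Proof.
move=> ac db acf eps /acf[r r0 Hr]; exists r => // n s e se; apply: Hr => i.
by have [? []] := se i; split; [lra|split; lra].
Qed.

Lemma absolutely_continuous_onD (R : realType) (V : normedModType R) (a b : R)
    (f g : R -> V) :
  absolutely_continuous_on a b f -> absolutely_continuous_on a b g ->
  absolutely_continuous_on a b (fun t => f t + g t).
Proof.
apply: (absolutely_continuous_on_lipschitz ler01) => s t _ _ _.
by rewrite mul1r opprD addrACA ler_normD.
Qed.

Lemma absolutely_continuous_onB (R : realType) (V : normedModType R) (a b : R)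
    (f g : R -> V) :
  absolutely_continuous_on a b f -> absolutely_continuous_on a b g ->
  absolutely_continuous_on a b (fun t => f t - g t).
Proof.
apply: (absolutely_continuous_on_lipschitz ler01) => s t _ _ _.
by rewrite mul1r opprD addrACA -opprD -[`|g t - _|]normrN ler_normD.
Qed.

Lemma absolutely_continuous_onZ (R : realType) (a b k : R) (f : R -> R) :
  absolutely_continuous_on a b f ->
  absolutely_continuous_on a b (fun t => k * f t).
Proof.
move=> acf.
apply: (absolutely_continuous_on_lipschitz (normr_ge0 k) _ acf acf) => s t _ _ _.
by rewrite -mulrBr normrM ler_wpM2l// lerDl.
Qed.

Lemma absolutely_continuous_on_cst (R : realType) (V : normedModType R)
  (a b : R) (c : V) : absolutely_continuous_on a b (fun=> c).
Proof.
move=> eps eps0; exists 1 => // n s e _ _ _.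
by rewrite big1 ?ltW// => i _; rewrite subrr normr0.
Qed.

Lemma absolutely_continuous_on_id (R : realType) (a b : R) :
  absolutely_continuous_on a b (id : R -> R).
Proof.
move=> eps eps0; exists eps => // n s e se _; apply: le_trans;
  apply: ler_sum => i _.
by have [_ [? _]] := se i; rewrite ger0_norm ?subr_ge0.
Qed.

(** * Disjoint open intervals and their total length *)

Lemma trivIset_itv_oo (R : realType) n (s e : nat -> R) :
    (forall i j, (i <= j)%N -> (j <= n)%N -> s i <= s j) ->
    (forall i, (i < n)%N -> e i <= s i.+1) ->
  trivIset [set: 'I_n] (fun i => `]s i, e i[%classic).
Proof.
move=> s_le es i j _ _ [t [/=]]; rewrite !in_itv/= => /andP[si ie] /andP[sj je].
have disj (k l : 'I_n) : (k < l)%N -> s l < t -> t < e k -> False.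
  move=> kl slt /lt_le_trans/(_ (es _ (ltn_ord k))).
  by move=> /lt_le_trans/(_ (s_le _ _ kl (ltnW (ltn_ord l))))/(lt_trans slt);
    rewrite ltxx.
by apply: ord_inj; case: (ltngtP i j) => // /disj H; exfalso; apply: H.
Qed.

Lemma sum_length_le_lebesgue (R : realType) (U : set R) n (s e : 'I_n -> R) :
    measurable U -> (forall i, s i <= e i) ->
    trivIset [set: 'I_n] (fun i => `]s i, e i[%classic) ->
    (forall i, `]s i, e i[%classic `<=` U) ->
  ((\sum_(i < n) (e i - s i))%:E <= @lebesgue_measure R U)%E.
Proof.
move=> mU se trse seU.
apply: (@le_trans _ _ (@lebesgue_measure R
    (\big[setU/set0]_(i < n) `]s i, e i[%classic))); last first.
  apply: le_measure; rewrite ?inE//.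
    by apply: bigsetU_measurable => i _; exact: measurable_itv.
  by elim/big_ind : _ => // A B AU BU t [/AU|/BU].
rewrite measure_bigsetU_ord// -sumEFin; apply: lee_sum => i _.
have := @lebesgue_measure_itv R `]s i, e i[; rewrite /= => ->.
rewrite lte_fin; case: ifPn => //.
by rewrite -leNgt => es; rewrite lee_fin subr_le0.
Qed.

(** Multiplying the difference quotient out by [s - t] lets the estimate include [s = t]. *)
Lemma is_derive_modulus (R : realType) (f : R -> R) (t l eps : R) :
    is_derive t 1 f l -> 0 < eps ->
  exists2 d, 0 < d & forall s, `|s - t| < d ->
    `|f s - f t - l * (s - t)| <= eps * `|s - t|.
Proof.
move=> [/cvg_ex[l' fl'] fl] eps0.
have {fl}l'E : l' = l by rewrite -fl; exact/esym/cvg_lim.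
rewrite {}l'E in fl'.
have /cvgrPdist_le/(_ _ eps0) := fl'.
rewrite near_withinE => /nbhs_ballP[d /= d0 Hd].
exists d => // s sd; have [->|st] := eqVneq s t.
  by rewrite !subrr mulr0 subr0 normr0 mulr0.
have st0 : s - t != 0 by rewrite subr_eq0.
have := Hd (s - t); rewrite -ball_normE/= sub0r normrN => /(_ sd st0).
rewrite [_%:A]mulr1 subrK distrC => H.
rewrite -ler_pdivrMr ?normr_gt0// -normfV -normrM.
by apply: le_trans H; rewrite le_eqVlt; apply/orP; left; apply/eqP; congr `|_|;
  rewrite /GRing.scale/=; field.
Qed.

(* By Cousin's lemma, [a, b] is cut into intervals on which either the slope of
   f is at most eps or which lie in an open set of small measure containing the
   exceptional points; absolute continuity makes the contribution of the latter
   small. *)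
Lemma absolutely_continuous_on_ae_derive_le0 (R : realType) (a b : R)
    (f : R -> R) : a <= b -> absolutely_continuous_on a b f ->
    {ae @lebesgue_measure R, forall t : R, a < t < b ->
      exists2 l, is_derive t 1 f l & l <= 0} ->
  f b <= f a.
Proof.
move=> ab acf aef; apply/ler_addgt0Pr => eps0 eps0_gt0.
(* The slopes cost [eps * (b - a)] and the exceptional intervals one more [eps]; the sum is [eps0],
   also when [a = b]. *)
pose eps := eps0 / (b - a + 1).
have eps_gt0 : 0 < eps by rewrite divr_gt0//; lra.
have epsE : eps0 = eps * (b - a) + eps by rewrite /eps; field; lra.
have [d d0 fd] := acf _ eps_gt0.
(* The endpoints join the exceptional set, since the derivative is only controlled inside []a,
   b[]. *)
have [N [mN N0 aefN]] : (@lebesgue_measure R).-negligible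
    (~` [set t | a < t < b -> exists2 l, is_derive t 1 f l & l <= 0]
       `|` [set a; b]).
  apply: negligibleU => //; apply/negligibleP.
    by apply: measurableU.
  by exact/countable_lebesgue_measure0/finite_set_countable/finite_set2.
have [|U [oU NU Ud]] := @lebesgue_regularity_outer R N d mN _ d0.
  by rewrite [X in (X < _)%E]N0.
have mU : measurable U by exact: measurable_realfun.open_measurable.
have {}Ud : (lebesgue_measure U < d%:E)%E.
  rewrite -(setDKU NU); apply: le_lt_trans Ud.
  apply: le_trans (measureU2 _ _ _) _ => //; first exact: measurableD.
  by rewrite [X in (_ + X <= _)%E]N0 adde0.
(* A path for [e] from [a] to [b] is a subdivision into intervals of small slope ([good]) or
   contained in [U] ([bad]). *)
pose bad u w := `[< `[u, w]%classic `<=` U >].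
pose good u w := f w - f u <= eps * (w - u).
pose e u w := (u <= w) && (good u w || bad u w).
have [s] : exists2 s, path e a s & last a s = b.
  pose P u w := exists2 s, path e u s & last u s = w.
  apply: (@cousin_ind _ P) => //.
    move=> u v w [s1 es1 l1] [s2 es2 l2]; exists (s1 ++ s2).
      by rewrite cat_path es1 l1.
    by rewrite last_cat l1.
  move=> t /andP[at_ tb]; have [Nt|nNt] := pselect (N t).
    have /nbhs_ballP[r /= r0 rU] : nbhs t U.
      by apply: open_nbhs_nbhs; split => //; exact: NU.
    exists r => // u w /andP[au ut] /andP[tw wb] ru rw; exists [:: w] => //=.
    rewrite andbT /e (le_trans ut tw)/=; apply/orP; right; apply/asboolP => z.
    rewrite /= in_itv/= => /andP[uz zw]; apply: rU.
    by rewrite -ball_normE/= ltr_norml; apply/andP; split; lra.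
  have ta : t != a by apply/eqP => ta; apply/nNt/aefN; right; left.
  have tb' : t != b by apply/eqP => tb'; apply/nNt/aefN; right; right.
  have [l fl l0] : exists2 l, is_derive t 1 f l & l <= 0.
    apply: contrapT => H; apply/nNt/aefN; left => /= H'; apply/H/H'.
    by rewrite !lt_neqAle eq_sym ta tb' at_.
  have [r r0 Hr] := is_derive_modulus fl eps_gt0.
  exists r => // u w /andP[au ut] /andP[tw wb] ru rw; exists [:: w] => //=.
  rewrite andbT /e (le_trans ut tw)/=; apply/orP; left.
  have wtE : `|w - t| = w - t by rewrite ger0_norm ?subr_ge0.
  have utE : `|u - t| = t - u by rewrite distrC ger0_norm ?subr_ge0.
  (* As [t] lies between [u] and [w], the one-sided estimates add up to a slope of at most
     [l + eps], with [l <= 0]. *)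
  have /Hr : `|w - t| < r by lra.
  have /Hr : `|u - t| < r by lra.
  rewrite wtE utE !ler_norml => /andP[H1 _] /andP[_ H2].
  have : l * (w - t) <= 0 by rewrite mulr_le0_ge0// subr_ge0.
  have : l * (t - u) <= 0 by rewrite mulr_le0_ge0// subr_ge0.
  rewrite /good; move: H1 H2; rewrite !mulrBr; lra.
pose tau i := nth a (a :: s) i; set n := size s.
move=> es lastb.
have tau0 : tau 0%N = a by [].
have taun : tau n = b by rewrite -lastb (last_nth a).
have etau i : (i < n)%N -> e (tau i) (tau i.+1) by move=> ?; exact/(pathP a).
have tau_le i j : (i <= j)%N -> (j <= n)%N -> tau i <= tau j.
  move=> ij jn; have srt : sorted <=%O (a :: s).
    by rewrite /=; apply: sub_path es => u w /andP[].
  apply: (le_sorted_leq_nth a srt) => //; rewrite inE/= ltnS//.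
  by rewrite (leq_trans ij jn).
(* Intervals that are not bad are collapsed to a point, so one family indexed by all [i < n]
   collects exactly the bad increments. *)
pose E i := if bad (tau i) (tau i.+1) then tau i.+1 else tau i.
have tauE i : (i < n)%N -> tau i <= E i <= tau i.+1.
  by move=> iltn; rewrite /E; case: ifP => _; rewrite lexx ?andbT tau_le.
have sumfE : \sum_(i < n) `|f (E i) - f (tau i)| <= eps.
  have trE : trivIset [set: 'I_n] (fun i => `]tau i, E i[%classic).
    by apply: trivIset_itv_oo tau_le _ => i /tauE/andP[].
  apply: fd => //.
    move=> i; have /andP[iE Ei] := tauE _ (ltn_ord i); split.
      by rewrite -tau0 tau_le// ltnW.
    by split=> //; rewrite (le_trans Ei)// -taun tau_le.
  rewrite -lee_fin; apply: le_trans (ltW Ud).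
  apply: sum_length_le_lebesgue => //.
    by move=> i; have /andP[] := tauE _ (ltn_ord i).
  move=> i; rewrite /E; case: ifPn => [/asboolP + t /=|_ t/=]; last first.
    by rewrite in_itv/= => /andP[? ?]; lra.
  by move=> + tt; apply; apply: subset_itv_oo_cc tt.
have telescope_tau (g : R -> R) :
    g b - g a = \sum_(i < n) (g (tau i.+1) - g (tau i)).
  rewrite -(big_mkord xpredT (fun i => g (tau i.+1) - g (tau i))).
  by rewrite (telescope_sumr (g \o tau))//= taun.
rewrite -lerBlDl telescope_tau epsE (telescope_tau id) mulr_sumr.
apply: le_trans (lerD (lexx _) sumfE).
(* Each increment is at most [eps] times the length plus [|f (E i) - f (tau i)|]: the first term
   suffices on a good interval, the second on a bad one. *)
rewrite -big_split/=; apply: ler_sum => i _.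
have /andP[ti /orP[gi|bi]] := etau _ (ltn_ord i).
  by apply: le_trans gi _; rewrite lerDl.
by rewrite /E bi; apply: le_trans (ler_norm _) _;
  rewrite lerDr mulr_ge0 ?subr_ge0// ltW.
Qed.

(** * Calculus with the inner product *)

Section inner_product_algebra.
Context (R : realType) (H : completeNormedModType R).
Variable dot : {dot H for idfun}.
Implicit Types (u w : H) (a : R).

Lemma dotC u w : dot u w = dot w u.
Proof. by rewrite (hermC dot) expr0 mul1r. Qed.

Lemma dotDl u u' w : dot (u + u') w = dot u w + dot u' w.
Proof. exact: linearDl. Qed.

Lemma dotNl u w : dot (- u) w = - dot u w.
Proof. exact: linearNl. Qed.

Lemma dotZl a u w : dot (a *: u) w = a * dot u w.
Proof. exact: linearZl_LR. Qed.

Lemma dotDr u w w' : dot u (w + w') = dot u w + dot u w'.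
Proof. exact: linearDr. Qed.

Lemma dotNr u w : dot u (- w) = - dot u w.
Proof. exact: linearNr. Qed.

Lemma dotZr a u w : dot u (a *: w) = a * dot u w.
Proof. exact: linearZr_LR. Qed.

Definition dotE := (dotDl, dotNl, dotZl, dotDr, dotNr, dotZr).

End inner_product_algebra.

Section inner_product.
Context (R : realType) (H : completeNormedModType R).
Variables (dot : {dot H for idfun}) (dot_norm : induces_norm dot).
Implicit Types (u w : H) (a b : R).

Lemma dotxx u : dot u u = `|u| ^+ 2.
Proof.
rewrite dot_norm sqr_sqrtr//; have [->|/neq0_dnorm_gt0/ltW//] := eqVneq u 0.
by rewrite linear0l.
Qed.

Lemma dot_cauchy_schwarz u w : `|dot u w| <= `|u| * `|w|.
Proof.
suff CS u' w' : dot u' w' <= `|u'| * `|w'|.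
  by rewrite ler_norml CS andbT lerNl -dotNr -(normrN w) CS.
have [->|u0] := eqVneq u' 0; first by rewrite linear0l normr0 mul0r.
have [->|w0] := eqVneq w' 0; first by rewrite linear0r normr0 mulr0.
have n0 : 0 < `|u'| * `|w'| by rewrite mulr_gt0 ?normr_gt0.
(* Expanded, this square is [2 |u'| |w'| (|u'| |w'| - dot u' w')]. *)
have : 0 <= dot (`|w'| *: u' - `|u'| *: w') (`|w'| *: u' - `|u'| *: w').
  by rewrite dotxx sqr_ge0.
rewrite !dotE !dotxx (dotC dot w') => h.
rewrite -(ler_pM2l n0); lra.
Qed.

Lemma cvg_dot (T : Type) (F : set_system T) (FF : Filter F) (g h : T -> H) u w :
  g t @[t --> F] --> u -> h t @[t --> F] --> w ->
  dot (g t) (h t) @[t --> F] --> dot u w.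
Proof.
move=> gu hw; apply/subr_cvg0 => /=.
(* Expanding around the limits leaves three terms, each with a factor tending to 0. *)
have -> : (fun t => dot (g t) (h t) - dot u w) =
          (fun t => dot (g t - u) (h t - w) +
                    (dot (g t - u) w + dot u (h t - w))).
  by apply/funext => t; rewrite !dotE; ring.
have bnd0 (p q : T -> H) : `|p t| * `|q t| @[t --> F] --> (0 : R) ->
    dot (p t) (q t) @[t --> F] --> (0 : R).
  move=> pq0; apply/norm_cvg0P; apply: squeeze_cvgr pq0; last exact: cvg_cst.
  by apply: nearW => t; rewrite normr_ge0 dot_cauchy_schwarz.
have gu0 : `|g t - u| @[t --> F] --> (0 : R).
  by apply/norm_cvg0P; apply/subr_cvg0.
have hw0 : `|h t - w| @[t --> F] --> (0 : R).
  by apply/norm_cvg0P; apply/subr_cvg0.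
rewrite -[X in _ --> X]addr0 -[X in _ --> X + _]addr0 -addrA.
apply: cvgD; last apply: cvgD; apply: bnd0.
- by rewrite -[X in _ --> X](mulr0 0); apply: cvgM.
- by rewrite -[X in _ --> X](mul0r `|w|); apply: cvgM => //; exact: cvg_cst.
- by rewrite -[X in _ --> X](mulr0 `|u|); apply: cvgM => //; exact: cvg_cst.
Qed.

Let derivable_shift (V : normedModType R) (g : R -> V) (t : R) :
  derivable g t 1 -> g (k%:A + t) @[k --> 0^'] --> g t.
Proof.
move=> /derivable1_diffP/differentiable_continuous gt.
apply: (@cvg_comp _ _ _ (fun k : R => k%:A + t) g _ (nbhs t)); last exact: gt.
have -> : (fun k : R => k%:A + t) = (fun k => k + t).
  by apply/funext => k; rewrite [_%:A]mulr1.
have : k + t @[k --> (0 : R)] --> 0 + t by apply: cvgD;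
  [exact: cvg_id|exact: cvg_cst].
by rewrite add0r; exact: cvg_within_filter.
Qed.

Let is_derive_cvg (V : normedModType R) (g : R -> V) (t : R) (l : V) :
  is_derive t 1 g l <-> k^-1 *: (g (k%:A + t) - g t) @[k --> 0^'] --> l.
Proof.
split=> [[/cvg_ex[l' gl'] <-]|gl].
  by have -> : 'D_1 g t = l' by exact: cvg_lim.
by apply: DeriveDef; [exact: cvgP gl|exact: cvg_lim].
Qed.

Lemma is_derive_dot (g h : R -> H) (t : R) (g' h' : H) :
  is_derive t 1 g g' -> is_derive t 1 h h' ->
  is_derive t 1 (fun s => dot (g s) (h s)) (dot g' (h t) + dot (g t) h').
Proof.
move=> dg dh; apply/is_derive_cvg.
have -> : (fun k =>
  k^-1 *: (dot (g (k%:A + t)) (h (k%:A + t)) - dot (g t) (h t))) =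
  (fun k => dot (k^-1 *: (g (k%:A + t) - g t)) (h (k%:A + t)) +
            dot (g t) (k^-1 *: (h (k%:A + t) - h t))).
  by apply/funext => k; rewrite !dotE /GRing.scale/=; ring.
move/is_derive_cvg : (dg) => dg'; move/is_derive_cvg : (dh) => dh'.
apply: cvgD; apply: cvg_dot => //.
  by apply: derivable_shift; exact: ex_derive.
exact: cvg_cst.
Qed.

(** The inner product is Lipschitz on bounded sets, and both curves are bounded on [[a, b]]. *)
Lemma absolutely_continuous_on_dot (a b : R) (g h : R -> H) : a <= b ->
  absolutely_continuous_on a b g -> absolutely_continuous_on a b h ->
  absolutely_continuous_on a b (fun t => dot (g t) (h t) : R).
Proof.
move=> ab acg ach.
have [M M0 gM] := absolutely_continuous_on_bounded ab acg.
have [N N0 hN] := absolutely_continuous_on_bounded ab ach.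
apply: (@absolutely_continuous_on_lipschitz _ _ _ _ a b (M + N) g h) =>
  // [|s t as_ st tb].
  lra.
have -> : dot (g t) (h t) - dot (g s) (h s) =
    dot (g t - g s) (h t) + dot (g s) (h t - h s).
  by rewrite !dotE; ring.
apply: le_trans (ler_normD _ _) _; rewrite mulrDr; apply: lerD.
  apply: le_trans (dot_cauchy_schwarz _ _) _; rewrite mulrC ler_wpM2r//.
  by apply: le_trans (hN t _) _; [rewrite (le_trans as_)|lra].
apply: le_trans (dot_cauchy_schwarz _ _) _; rewrite ler_wpM2r//.
by apply: le_trans (gM s _) _; [rewrite as_ (le_trans st)|lra].
Qed.

(** Testing the subgradient inequality at a point of finite value excludes [+oo]. This is what makes
    [fine] faithful along a solution. *)
Lemma subdifferential_fin_num (Phi : H -> \bar R) (u p : H) :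
  proper_fun Phi -> subdifferential dot Phi u p -> Phi u \is a fin_num.
Proof.
move=> [PhiNy [w Phiw]] /(_ w); rewrite fin_numE PhiNy/=.
by case: (Phi u) => //=; move: Phiw; case: (Phi w).
Qed.

(** * Chain rule for a convex function along a curve with subgradients *)

Section subgradient_curve.
Variables (x v : R -> H) (phi : R -> R).
Hypothesis phi_sub : forall s t, 0 <= s -> 0 <= t ->
  phi t + dot (v t) (x s - x t) <= phi s.

(** The subgradient inequalities at both ends bound the increment of [phi] by that of [x] times a
    bound for [|v|] on [[0, b]]. *)
Lemma absolutely_continuous_on_subgradient (b : R) : 0 <= b ->
  absolutely_continuous_on 0 b x -> absolutely_continuous_on 0 b v ->
  absolutely_continuous_on 0 b phi.
Proof.
move=> b0 acx acv.
have [M M0 vM] := absolutely_continuous_on_bounded b0 acv.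
apply: (@absolutely_continuous_on_lipschitz _ _ _ _ 0 b M x v) =>
  // [|s t s0 st tb].
  exact: ltW.
have t0 := le_trans s0 st.
apply: (@le_trans _ _ (M * `|x t - x s|)); last first.
  by rewrite ler_wpM2l ?lerDl// ltW.
have bnd r d : 0 <= r <= b -> dot (v r) d <= M * `|d|.
  move=> rb; apply: le_trans (ler_norm _) _;
    apply: le_trans (dot_cauchy_schwarz _ _) _.
  by rewrite ler_wpM2r// vM.
have := phi_sub s0 t0; have := phi_sub t0 s0.
have := bnd t (x t - x s); have := bnd s (x s - x t).
rewrite [`|x s - _|]distrC !dotE ler_norml s0 t0 tb (le_trans st tb)/=.
move=> /(_ isT) h1 /(_ isT) h2 h3 h4; apply/andP; split; lra.
Qed.

(* The increment of phi is squeezed between the pairings of the increment of x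
   with v at both of its ends. *)
Lemma is_derive_subgradient (t : R) (x' : H) : 0 < t ->
  is_derive t 1 x x' -> derivable v t 1 -> is_derive t 1 phi (dot (v t) x').
Proof.
move=> t0 dx dv; apply/is_derive_cvg.
move/is_derive_cvg : (dx) => dx'.
pose dq k := k^-1 *: (x (k%:A + t) - x t).
have low : dot (v t) (dq k) @[k --> 0^'] --> dot (v t) x'.
  by apply: cvg_dot => //; exact: cvg_cst.
have up : dot (v (k%:A + t) - v t) (dq k) @[k --> 0^'] --> 0.
  rewrite -[X in _ --> X](linear0l dot x'); apply: cvg_dot => //.
  by apply/subr_cvg0; exact: derivable_shift.
apply/subr_cvg0 => /=; rewrite -[X in _ --> X]addr0.
rewrite (_ : (fun k => _ - _) = (fun k => (k^-1 *: (phi (k%:A + t) - phi t) -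
   dot (v t) (dq k)) + (dot (v t) (dq k) - dot (v t) x'))); last first.
  by apply/funext => k /=; ring.
apply: cvgD; last exact/subr_cvg0.
have {}up : `|dot (v (k%:A + t) - v t) (dq k)| @[k --> 0^'] --> (0 : R).
  exact/norm_cvg0P.
apply/norm_cvg0P; apply: squeeze_cvgr up; last exact: cvg_cst.
(* Radius [t] keeps [k + t] nonnegative, where [phi_sub] is available. *)
rewrite near_withinE; apply/nbhs_ballP; exists t => //= k.
rewrite -ball_normE/= sub0r normrN => kt k0; rewrite normr_ge0/=.
have kt0 : 0 <= k + t by have := ler_norm (- k); rewrite normrN; lra.
rewrite [_%:A]mulr1 -[dot (v t) _]mulr1 /dq.
rewrite !(dotZr _ _ _ (x _ - x t)) [_%:A]mulr1 mulr1.
rewrite [X in `|X - _|]/(GRing.scale _ _)/= -mulrBr !normrM ler_wpM2l//.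
(* With [d] the increment of [x], these two inequalities say that the increment of [phi] minus
   [dot (v t) d] lies between 0 and [dot (v (k + t) - v t) d]. *)
have := phi_sub (ltW t0) kt0; have := phi_sub kt0 (ltW t0).
rewrite -(opprB (x t)) !dotE => h1 h2; rewrite !ger0_norm; lra.
Qed.

End subgradient_curve.

End inner_product.

(** * Energy estimates *)

Section dynamics.
Context (R : realType) (H : completeNormedModType R).
Variables (dot : {dot H for idfun}) (dot_norm : induces_norm dot).
Variables (Phi : H -> \bar R) (Phi_proper : proper_fun Phi).
Variables (B : H -> H) (beta : R) (beta_gt0 : 0 < beta).
Hypothesis B_cocoercive : cocoercive dot beta B.
Variables (lambda : R) (lambda_gt0 : 0 < lambda).
Variables (x v : R -> H).
Hypothesis xv_solution : strong_global_solution dot Phi B lambda x v.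

Let phi t := fine (Phi (x t)).
Let q t := v t + B (x t).

Let phiE t : 0 <= t -> Phi (x t) = (phi t)%:E.
Proof.
case: xv_solution => _ sub _ t0.
by rewrite fineK//; apply: subdifferential_fin_num (sub _ t0).
Qed.

Lemma solution_subgradient s t : 0 <= s -> 0 <= t ->
  phi t + dot (v t) (x s - x t) <= phi s.
Proof.
case: (xv_solution) => _ sub _ s0 t0; have := sub _ t0 (x s).
by rewrite !phiE// -EFinD lee_fin.
Qed.

Let solution_absolutely_continuous b : 0 <= b ->
  absolutely_continuous_on 0 b x /\ absolutely_continuous_on 0 b v.
Proof.
case: xv_solution => ac _ _ b0.
(* A solution is controlled on [[0, b]] for [0 < b] only; passing to [b + 1] covers [b = 0]. *)
have [|acx acv] := ac (b + 1); first lra.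
by split; [apply: absolutely_continuous_onS acx
          |apply: absolutely_continuous_onS acv]; lra.
Qed.

Let solution_ae : {ae @lebesgue_measure R, forall t : R, 0 < t ->
  exists x' v', [/\ is_derive t 1 x x', is_derive t 1 v v' &
    lambda *: x' + v' = - q t]}.
Proof.
case: xv_solution => _ _.
apply: (@filterS _ _ (ae_filter_ringOfSetsType (@lebesgue_measure R))) =>
  t + t0.
move=> /(_ (ltW t0))[/derivableP dx /derivableP dv eqn].
exists ('D_1 x t), ('D_1 v t); split => //.
by apply/eqP; rewrite -addr_eq0 /q addrA -!derive1E eqn.
Qed.

(** * Energy and Lyapunov functions relative to an equilibrium *)

Section equilibrium.
Variables (z p : H) (z_sub : subdifferential dot Phi z p) (pz : p + B z = 0).

Let phiz := fine (Phi z).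

Let phizE : Phi z = phiz%:E.
Proof. by rewrite fineK//; exact: subdifferential_fin_num z_sub. Qed.

Let pE : p = - B z.
Proof. by apply/eqP; rewrite -addr_eq0 pz. Qed.

(** The second summand is the Bregman distance of [Phi] from [x t] to [z], taken with the
    subgradient [v t]. *)
Definition energy t : R :=
  lambda / 2 * dot (x t - z) (x t - z) + (phiz - phi t - dot (v t) (z - x t)).

Lemma bregman_ge0 t : 0 <= t -> 0 <= phiz - phi t - dot (v t) (z - x t).
Proof.
case: (xv_solution) => _ sub _ t0; have := sub _ t0 z.
by rewrite phiE// phizE -EFinD lee_fin => h; lra.
Qed.

Lemma energy_ge0 t : 0 <= t -> 0 <= energy t.
Proof.
move=> t0; apply: addr_ge0; last exact: bregman_ge0.
by rewrite dotxx// mulr_ge0 ?sqr_ge0 ?divr_ge0 ?(ltW lambda_gt0).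
Qed.

(** Since [- B z] is a subgradient at [z], the point [z] minimises [Phi] plus the linear form of
    [B z]. This bounds [lyapunov] from below. *)
Lemma equilibrium_subgradient t : 0 <= t ->
  phiz + dot (B z) z <= phi t + dot (B z) (x t).
Proof.
move=> t0; have := z_sub (x t).
by rewrite phiE// phizE -EFinD lee_fin pE !dotE => h; lra.
Qed.

(** The subgradient inequalities at [x t] and at [z] add up to [0 <= dot (v t - p) (x t - z)];
    cocoercivity supplies the rest. *)
Lemma dissipation t : 0 <= t ->
  beta * dot (B (x t) - B z) (B (x t) - B z) <= dot (q t) (x t - z).
Proof.
move=> t0; have := B_cocoercive (x t) z; rewrite -(dotxx dot_norm).
have := bregman_ge0 t0; have := equilibrium_subgradient t0.
rewrite /q !dotE; lra.
Qed.

(** The term [- dot (v t) x'] coming from [phi] cancels against the one obtained by differentiating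
    [x] in [- dot (v t) (z - x t)]. *)
Lemma is_derive_energy (t : R) (x' v' : H) : 0 < t ->
  is_derive t 1 x x' -> is_derive t 1 v v' ->
  is_derive t 1 energy (dot (lambda *: x' + v') (x t - z)).
Proof.
move=> t0 dx dv.
have dphi := is_derive_subgradient dot_norm solution_subgradient t0 dx
  (ex_derive (is_derive := dv)).
have dxz : is_derive t 1 (fun s => x s - z) x'.
  by have := is_deriveB dx (is_derive_cst z t 1); rewrite subr0.
have dzx : is_derive t 1 (fun s => z - x s) (- x').
  by have := is_deriveB (is_derive_cst z t 1) dx; rewrite sub0r.
have d1 := is_derive_dot dot_norm dxz dxz.
have d2 := is_derive_dot dot_norm dv dzx.
have denergy : is_derive t 1 energy _ := is_deriveD (is_deriveZ (lambda / 2) d1)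
  (is_deriveB (is_deriveB (is_derive_cst phiz t 1) dphi) d2).
apply: is_derive_eq denergy _.
rewrite /GRing.scale/= !dotE !(dotC dot _ x'); lra.
Qed.

Lemma absolutely_continuous_on_energy b : 0 <= b ->
  absolutely_continuous_on 0 b energy.
Proof.
move=> b0; have [acx acv] := solution_absolutely_continuous b0.
have acphi := absolutely_continuous_on_subgradient dot_norm
  solution_subgradient b0 acx acv.
have cst0 (V : normedModType R) (c : V) :=
  @absolutely_continuous_on_cst R V 0 b c.
have acxz : absolutely_continuous_on 0 b (fun t => x t - z).
  exact: absolutely_continuous_onB.
have aczx : absolutely_continuous_on 0 b (fun t => z - x t).
  exact: absolutely_continuous_onB.
apply: absolutely_continuous_onD.
  by apply: absolutely_continuous_onZ; exact: absolutely_continuous_on_dot.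
apply: absolutely_continuous_onB; first exact: absolutely_continuous_onB.
exact: absolutely_continuous_on_dot.
Qed.

Lemma energy_nonincreasing s t : 0 <= s -> s <= t -> energy t <= energy s.
Proof.
move=> s0 st; have t0 := le_trans s0 st.
apply: absolutely_continuous_on_ae_derive_le0 => //.
  exact: absolutely_continuous_onS (absolutely_continuous_on_energy t0).
apply: (@filterS _ _ (ae_filter_ringOfSetsType _)) solution_ae =>
  r + /andP[sr rt].
have r0 : 0 < r by exact: le_lt_trans sr.
move=> /(_ r0)[x' [v' [dx dv eqn]]].
exists (dot (lambda *: x' + v') (x r - z)); first exact: is_derive_energy.
rewrite eqn dotNl oppr_le0; apply: le_trans (dissipation (ltW r0)).
by rewrite mulr_ge0 ?(ltW beta_gt0)// dotxx// sqr_ge0.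
Qed.

Definition lyapunov t : R :=
  (2 * beta)^-1 * energy t + (lambda * (phi t + dot (B z) (x t)) +
    2^-1 * dot (v t + B z) (v t + B z)).

Lemma lyapunov_ge t :
  0 <= t -> lambda * (phi t + dot (B z) (x t)) <= lyapunov t.
Proof.
move=> t0; have : 0 <= (2 * beta)^-1 * energy t.
  by rewrite mulr_ge0 ?energy_ge0// invr_ge0 mulr_ge0// ltW.
have : 0 <= dot (v t + B z) (v t + B z) by rewrite dotxx// sqr_ge0.
rewrite /lyapunov; lra.
Qed.

(* Since lambda x' + v' = - q, the derivatives of the last two terms add up to
   - <v + B z, q> = - |q|^2 + <B x - B z, q>, and the first term, which
   dissipates |B x - B z|^2 / 2, absorbs half of the cross term. *)
Lemma is_derive_lyapunov (t : R) (x' v' : H) : 0 < t ->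
  is_derive t 1 x x' -> is_derive t 1 v v' -> lambda *: x' + v' = - q t ->
  exists2 l, is_derive t 1 lyapunov l & l <= - 2^-1 * `|q t| ^+ 2.
Proof.
move=> t0 dx dv eqn.
have denergy := is_derive_energy t0 dx dv.
have dphi := is_derive_subgradient dot_norm solution_subgradient t0 dx
  (ex_derive (is_derive := dv)).
have dBx := is_derive_dot dot_norm (is_derive_cst (B z) t 1) dx.
have dvB : is_derive t 1 (fun s => v s + B z) v'.
  by have := is_deriveD dv (is_derive_cst (B z) t 1); rewrite addr0.
have dvB2 := is_derive_dot dot_norm dvB dvB.
have dlyap : is_derive t 1 lyapunov _ := is_deriveD
  (is_deriveZ (2 * beta)^-1 denergy)
  (is_deriveD (is_deriveZ lambda (is_deriveD dphi dBx)) (is_deriveZ 2^-1 dvB2)).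
eexists; first exact: dlyap.
rewrite /GRing.scale/= linear0l add0r eqn.
(* Once [v'] is eliminated, all terms in [x'] cancel. *)
have -> : v' = - q t - lambda *: x' by rewrite -eqn addrC addKr.
have := dissipation (ltW t0); set b := B (x t) - B z; rewrite dotNl.
set X := dot (q t) _ => h.
have {}h : 2^-1 * dot b b <= (2 * beta)^-1 * X.
  have -> : 2^-1 * dot b b = (2 * beta)^-1 * (beta * dot b b).
    by field; rewrite gt_eqF.
  by rewrite ler_pM2l// invr_gt0 mulr_gt0.
have vBE : v t + B z = q t - b
  by rewrite /q /b opprB -addrA [B (x t) + _]addrC subrK.
have vE : v t = q t - b - B z by rewrite -vBE addrK.
rewrite vBE vE -(dotxx dot_norm).
(* The derivative exceeds [- |q|^2 / 2] by at most [- |q - b|^2 / 2]. *)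
have : 0 <= dot (q t - b) (q t - b) by rewrite dotxx// sqr_ge0.
clearbody b X; move: (q t) => qt.
rewrite !dotE !(dotC dot _ x') !(dotC dot b qt); lra.
Qed.

Lemma absolutely_continuous_on_lyapunov b : 0 <= b ->
  absolutely_continuous_on 0 b lyapunov.
Proof.
move=> b0; have [acx acv] := solution_absolutely_continuous b0.
have acphi := absolutely_continuous_on_subgradient dot_norm
  solution_subgradient b0 acx acv.
have cst0 (V : normedModType R) (c : V) :=
  @absolutely_continuous_on_cst R V 0 b c.
apply: absolutely_continuous_onD.
  by apply: absolutely_continuous_onZ; exact: absolutely_continuous_on_energy.
apply: absolutely_continuous_onD; apply: absolutely_continuous_onZ.
  by apply: absolutely_continuous_onD => //;
    exact: absolutely_continuous_on_dot.
have acvB : absolutely_continuous_on 0 b (fun t => v t + B z).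
  exact: absolutely_continuous_onD.
exact: absolutely_continuous_on_dot.
Qed.

(** Adding [c r / 2] to [lyapunov r] leaves a derivative of at most [(c - |q r|^2) / 2]. Taking
    [c = 0] gives monotonicity, and [c = eps ^+ 2] a linear decay. *)
Lemma lyapunov_decrease (c s t : R) : 0 <= s -> s <= t ->
    (forall r, s < r < t -> c <= `|q r| ^+ 2) ->
  lyapunov t + 2^-1 * c * (t - s) <= lyapunov s.
Proof.
move=> s0 st qc; have t0 := le_trans s0 st.
suff : lyapunov t + 2^-1 * c * t <= lyapunov s + 2^-1 * c * s by lra.
apply: (@absolutely_continuous_on_ae_derive_le0 _ s t
  (fun r => lyapunov r + 2^-1 * c * r)) => //.
  apply: (@absolutely_continuous_onS _ _ 0 t) => //.
  apply: absolutely_continuous_onD;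
    first exact: absolutely_continuous_on_lyapunov.
  by apply: absolutely_continuous_onZ; exact: absolutely_continuous_on_id.
apply: (@filterS _ _ (ae_filter_ringOfSetsType _)) solution_ae =>
  r + /andP[sr rt].
have r0 : 0 < r by exact: le_lt_trans sr.
move=> /(_ r0)[x' [v' [dx dv /(is_derive_lyapunov r0 dx dv)[l dl lq]]]].
exists (l + 2^-1 * c * 1).
  exact: (is_deriveD dl (is_deriveZ (2^-1 * c) (is_derive_id r 1))).
have := qc r; rewrite sr rt => /(_ isT); lra.
Qed.

(** The energy bounds [x - z], as its Bregman part is nonnegative; [lyapunov] then bounds [phi] up
    to the bounded term [dot (B z) (x t)]. The trajectory thus stays in a set covered by
    inf-compactness. *)
Lemma solution_bounded : exists a M : R, 0 < M /\
  forall t, 0 <= t -> `|x t - z| <= M /\ phi t <= a.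
Proof.
(* The added 1 makes [M] a positive radius. *)
pose M := Num.sqrt (2 / lambda * energy 0) + 1.
have xM t : 0 <= t -> `|x t - z| <= M.
  move=> t0; have := bregman_ge0 t0; have := energy_nonincreasing (lexx 0) t0.
  rewrite [energy t]/energy dotxx// => h1 h2.
  have h3 : lambda / 2 * `|x t - z| ^+ 2 <= energy 0 by lra.
  apply: (@le_trans _ _ (Num.sqrt (2 / lambda * energy 0))); last
    by rewrite lerDl.
  rewrite -(ger0_norm (normr_ge0 (x t - z))) -sqrtr_sqr ler_wsqrtr//.
  have -> : `|x t - z| ^+ 2 = 2 / lambda * (lambda / 2 * `|x t - z| ^+ 2).
    by field; rewrite gt_eqF.
  by rewrite ler_wpM2l// divr_ge0// ltW.
exists (lambda^-1 * lyapunov 0 + `|B z| * (M + `|z|)), M; split.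
  by rewrite ltr_wpDl.
move=> t t0; split; first exact: xM.
have := @lyapunov_decrease 0 0 t (lexx 0) t0 (fun _ _ => sqr_ge0 _).
rewrite mulr0 mul0r addr0 => h.
have {}h : phi t + dot (B z) (x t) <= lambda^-1 * lyapunov 0.
  by rewrite ler_pdivlMl//; apply: le_trans h; exact: lyapunov_ge.
suff : - dot (B z) (x t) <= `|B z| * (M + `|z|) by lra.
rewrite -dotNr; apply: le_trans (ler_norm _) _.
apply: le_trans (dot_cauchy_schwarz dot_norm _ _) _; rewrite ler_wpM2l// normrN.
by rewrite -[x t](subrK z); apply: le_trans (ler_normD _ _) _;
  rewrite lerD2r xM.
Qed.

Lemma residual_small (eps T : R) : 0 < eps -> 0 <= T ->
  exists2 t, T <= t & `|q t| < eps.
Proof.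
move=> eps0 T0; apply: contrapT => Nq.
have qe t : T <= t -> eps <= `|q t|.
  by move=> Tt; rewrite leNgt; apply/negP => qt; apply: Nq; exists t.
pose m := lambda * (phiz + dot (B z) z).
(* If [|q|] stayed above [eps], a time [D] would suffice for [lyapunov] to fall to [m - 1], below
   its lower bound [m]. *)
pose D := (lyapunov T - m + 1) / (2^-1 * eps ^+ 2).
have e20 : 0 < 2^-1 * eps ^+ 2 by rewrite mulr_gt0 ?exprn_gt0.
have lyap_ge t : 0 <= t -> m <= lyapunov t.
  move=> t0; apply: le_trans (lyapunov_ge t0).
  by rewrite ler_pM2l//; exact: equilibrium_subgradient.
have D0 : 0 <= D.
  by rewrite divr_ge0 ?(ltW e20)//; have := lyap_ge _ T0; lra.
have /lyapunov_decrease : forall r, T < r < T + D -> eps ^+ 2 <= `|q r| ^+ 2.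
  by move=> r /andP[Tr _]; rewrite lerXn2r ?nnegrE ?(ltW eps0)// qe// ltW.
rewrite lerDl => /(_ T0 D0).
have -> : T + D - T = D by ring.
have := lyap_ge _ (addr_ge0 T0 D0).
have -> : 2^-1 * eps ^+ 2 * D = lyapunov T - m + 1
  by rewrite /D mulrC divfK ?gt_eqF.
lra.
Qed.

End equilibrium.
End dynamics.

(** * Convergence *)

(** By Cauchy-Schwarz, cocoercivity makes [B] Lipschitz with constant [beta^-1]. *)
Lemma cocoercive_continuous (R : realType) (H : completeNormedModType R)
    (dot : {dot H for idfun}) (dot_norm : induces_norm dot) (beta : R)
    (B : H -> H) :
  0 < beta -> cocoercive dot beta B -> continuous B.
Proof.
move=> beta0 coB u; apply/cvgrPdist_lt => eps eps0.
near=> w.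
have [->|BN] := eqVneq (B u - B w) 0; first by rewrite normr0.
have N0 : 0 < `|B u - B w| by rewrite normr_gt0.
have : beta * `|B u - B w| <= `|u - w|.
  rewrite -(ler_pM2l N0) mulrCA -expr2; apply: le_trans (coB u w) _.
  exact: le_trans (ler_norm _) (dot_cauchy_schwarz dot_norm _ _).
rewrite -ler_pdivlMl// => /le_lt_trans; apply; rewrite ltr_pdivrMl//.
near: w; apply/nbhs_ballP; exists (beta * eps); first by rewrite /= mulr_gt0.
by move=> w; rewrite -ball_normE.
Unshelve. all: by end_near. Qed.

Theorem corollary1p18 (R : realType) (H : completeNormedModType R)
    (dot : {dot H for idfun}) (dot_norm : induces_norm dot)
    (Phi : H -> \bar R) (Phi_convex : convex_efun Phi)
    (Phi_lsc : lower_semicontinuous Phi) (Phi_proper : proper_fun Phi)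
    (B : H -> H) (beta : R) (beta_gt0 : 0 < beta)
    (B_cocoercive : cocoercive dot beta B)
    (lambda : R) (lambda_gt0 : 0 < lambda)
    (S_neq0 : solution_set dot Phi B !=set0)
    (Phi_inf_compact : boundedly_inf_compact Phi)
    (x v : R -> H)
    (xv_solution : strong_global_solution dot Phi B lambda x v) :
  exists2 xoo : H, solution_set dot Phi B xoo & x t @[t --> +oo] --> xoo.
Proof.
have phiE t : 0 <= t -> Phi (x t) = (fine (Phi (x t)))%:E.
  case: (xv_solution) => _ sub _ t0.
  by rewrite fineK//; apply: subdifferential_fin_num (sub _ t0).
case: S_neq0 => z [p z_sub pz].
have [a [M [M0 bnd]]] := solution_bounded dot_norm Phi_proper beta_gt0
  B_cocoercive lambda_gt0 xv_solution z_sub pz.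
have small (n : nat) : exists t, n%:R <= t /\ `|v t + B (x t)| < n.+1%:R^-1.
  have n0 : 0 < n.+1%:R^-1 :> R by rewrite invr_gt0.
  have [t nt qt] := residual_small dot_norm Phi_proper beta_gt0
    B_cocoercive lambda_gt0 xv_solution z_sub pz n0 (ler0n R n).
  by exists t.
have [r rP] := choice small.
have [K subK [cptK _]] := Phi_inf_compact a z M M0.
have r0 n : 0 <= r n by apply: le_trans (rP n).1.
have [xoo [_ xooP]] : K `&` cluster (x \o r @ \oo) !=set0.
  apply: cptK; exists 0%N => // n _; apply: subK; have [xM pa] := bnd _ (r0 n).
  split; first by rewrite /= phiE// lee_fin.
  by rewrite closed_ballE// /closed_ball_/= distrC.
(* The cluster point meets every tail of [x \o r] in every ball, so choosing one time per [n]
   replaces the extraction of a subsequence. *)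
have near_xoo (n : nat) :
  exists t, [/\ n%:R <= t, `|v t + B (x t)| < n.+1%:R^-1 &
    `|xoo - x t| < n.+1%:R^-1].
  have n0 : 0 < n.+1%:R^-1 :> R by rewrite invr_gt0.
  have [||_ [[m nm <-] xm]] :=
    xooP [set x (r m) | m in [set m | (n <= m)%N]] (ball xoo n.+1%:R^-1).
  - by exists n => // m /= nm; exists m.
  - exact: nbhsx_ballx.
  have [rm qm] := rP m; exists (r m); split.
  - by apply: le_trans rm; rewrite ler_nat.
  - by apply: lt_le_trans qm _; rewrite lef_pV2 ?posrE// ler_nat.
  - by move: xm; rewrite -ball_normE.
have [s sP] := choice near_xoo.
have s0 n : 0 <= s n by have [+ _ _] := sP n; exact: le_trans.
have inv0 : n.+1%:R^-1 @[n --> \oo] --> (0 : R) := @cvg_harmonic R.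
have xs : x (s n) @[n --> \oo] --> xoo.
  apply/subr_cvg0/norm_cvg0P; apply: squeeze_cvgr inv0; last exact: cvg_cst.
  by apply: nearW => n; have [_ _ /ltW] := sP n; rewrite distrC normr_ge0.
have vs : v (s n) @[n --> \oo] --> - B xoo.
  have qs : v (s n) + B (x (s n)) @[n --> \oo] --> 0.
    apply/norm_cvg0P; apply: squeeze_cvgr inv0; last exact: cvg_cst.
    by apply: nearW => n; have [_ /ltW ? _] := sP n; rewrite normr_ge0.
  have Bs : B (x (s n)) @[n --> \oo] --> B xoo.
    apply: (@cvg_comp _ _ _ (x \o s) B _ (nbhs xoo)) => //.
    exact: (cocoercive_continuous dot_norm beta_gt0 B_cocoercive).
  rewrite -[X in _ --> X]add0r.
  have -> : (fun n => v (s n)) = (fun n => v (s n) + B (x (s n)) - B (x (s n))).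
    by apply/funext => n; rewrite addrK.
  exact: cvgB.
have dots y :
    dot (v (s n)) (y - x (s n)) @[n --> \oo] --> dot (- B xoo) (y - xoo).
  by apply: (cvg_dot dot_norm _ vs); apply: cvgB xs; exact: cvg_cst.
have lsc_s e : (e%:E < Phi xoo)%E ->
    \forall n \near \oo, (e%:E < Phi (x (s n)))%E.
  move=> /Phi_lsc[V Vxoo VP].
  have : \forall n \near \oo, V (x (s n)) by exact: xs.
  by apply: filterS => n; exact: VP.
(* If the inequality failed at [y], lower semicontinuity and the convergence of [x (s n)] and
   [v (s n)] would make it fail at some [s n]. *)
have xoo_sub : subdifferential dot Phi xoo (- B xoo).
  move=> y; rewrite leNgt; apply/negP => ylt.
  have Phiy : Phi y = (fine (Phi y))%:E.
    by rewrite fineK// fin_numE Phi_proper.1 -ltey (lt_le_trans ylt)// leey.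
  pose c := fine (Phi y) - dot (- B xoo) (y - xoo).
  (* [Phi xoo] is not yet known to be finite: [e] is a midpoint if it is, and [c + 1] otherwise. *)
  have [e ce eP] : exists2 e, c < e & (e%:E < Phi xoo)%E.
    move: ylt; rewrite Phiy; case: (Phi xoo) (Phi_proper.1 xoo) => [f| |]//= _.
      rewrite -EFinD lte_fin => ylt; exists ((c + f) / 2); rewrite ?lte_fin /c;
        lra.
    by move=> _; exists (c + 1); rewrite ?ltry ?ltrDl.
  have cs : fine (Phi y) - dot (v (s n)) (y - x (s n)) @[n --> \oo] --> c.
    by apply: cvgB; [exact: cvg_cst|exact: dots].
  have [n [lt1 lt2]] := filter_ex (filterI (cvgr_lt _ cs _ ce) (lsc_s _ eP)).
  case: (xv_solution) => _ /(_ _ (s0 n))/(_ y) + _; apply/negP; rewrite -ltNge.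
  move: lt2; rewrite phiE// Phiy -EFinD !lte_fin => lt2.
  by move: lt1 => /=; lra.
have xoo_sol : solution_set dot Phi B xoo.
  by exists (- B xoo) => //; rewrite addNr.
exists xoo => //.
have xooE : Phi xoo = (fine (Phi xoo))%:E.
  by rewrite fineK//; apply: subdifferential_fin_num xoo_sub.
pose E t := energy dot Phi lambda x v xoo t.
(* From here on [xoo] itself serves as the equilibrium in the energy estimates. *)
have Edecr t t' : 0 <= t -> t <= t' -> E t' <= E t.
  apply: (energy_nonincreasing dot_norm Phi_proper beta_gt0 B_cocoercive
    xv_solution xoo_sub); by rewrite addNr.
have Esmall eps : 0 < eps -> exists n, E (s n) < eps.
  move=> eps0; have eps20 : 0 < eps / 2 by rewrite divr_gt0.
  (* These are the terms of the energy without [Phi]. The remaining [Phi xoo - Phi (x (s n))] is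
     eventually below [eps / 2] by lower semicontinuity. *)
  have Gs : lambda / 2 * dot (x (s n) - xoo) (x (s n) - xoo) -
      dot (v (s n)) (xoo - x (s n)) @[n --> \oo] --> (0 : R).
    have xs0 : x (s n) - xoo @[n --> \oo] --> (0 : H) by apply/subr_cvg0.
    have -> : (0 : R) = lambda / 2 * dot (0 : H) 0 - dot (- B xoo) (xoo - xoo).
      by rewrite subrr !linear0r ?mulr0 subr0.
    by apply: cvgB => //; apply: cvgM; [exact: cvg_cst|exact: cvg_dot].
  have near_xooE : ((fine (Phi xoo) - eps / 2)%:E < Phi xoo)%E.
    by rewrite xooE lte_fin; lra.
  have [n [lt1 lt2]] :=
    filter_ex (filterI (cvgr_lt _ Gs _ eps20) (lsc_s _ near_xooE)).
  exists n; move: lt2; rewrite phiE// lte_fin /E /energy => lt2.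
  by move: lt1 => /=; lra.
apply/cvgrPdist_lt => eps eps0.
have l20 : 0 < lambda / 2 by rewrite divr_gt0.
(* As the Bregman part is nonnegative, an energy below [lambda / 2 * eps ^+ 2] forces
   [|x t - xoo| < eps]. *)
have [n En] := Esmall _ (mulr_gt0 l20 (exprn_gt0 2 eps0)).
exists (s n); split; first exact: num_real.
move=> t snt; rewrite distrC.
have t0 : 0 <= t by apply: le_trans (s0 n) (ltW snt).
have := Edecr _ _ (s0 n) (ltW snt).
have := bregman_ge0 Phi_proper xv_solution xoo_sub t0.
rewrite [E t]/E /energy (dotxx dot_norm) => h1 h2.
have : lambda / 2 * `|x t - xoo| ^+ 2 < lambda / 2 * eps ^+ 2 by lra.
by rewrite ltr_pM2l// ltr_pXn2r ?nnegrE// ltW.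
Qed.
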